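(* Consider the scalar case $n=m=1$ with model class $\mathcal M=\{(a,b),(a,-b)\}$, where $a>0$ and $b>0$. Let $s=1$, $r=0$, $E=\frac ab$, $K_+=-E$ and $K_-=E$, and consider the certainty equivalence (CE) controller $$u_t=-k_t\tfrac ab x_t,\qquad k_t=\arg\min_{\sigma\in\{+,-\}}z_t^{(\sigma)}.$$ Then, with $p_+=p_-=p$, the sufficient conditions (i)–(iii) listed in the context reduce to the scalar inequalities $$\text{(i)}\ \ p\ge1,\qquad\text{(ii)}\ \ h\ge1+2ap,\qquad\text{(iii)}\ \ h\ge1+2ah-\gamma a.$$ Moreover, the smallest value of $\gamma$ for which there exist $p,h\in[0,\gamma]$ satisfying (i)–(iii) is $$\gamma^{\mathrm{CE}}(a)=\max\{1+2a,\,4a\}=\begin{cases}1+2a,&0<a\le\frac12,\\ 4a,&a\ge\frac12.\end{cases}$$ The corresponding minimizing values are $p^\star=1$ and $h^\star=1+2a$, and the CE policy (with the cost $J_\mu$ taken for this value $\gamma=\gamma^{\mathrm{CE}}(a)$) satisfies the cost bound $J_\mu(x_0)\le(1+2a)x_0$.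
   Context: The signs $\sigma,k\in\{+,-\}$ act as $\pm1$ in arithmetic expressions; $\mathbb N$ includes $0$; $\gamma\ge0$ is a scalar. Sufficient conditions. For $n=m=1$, $A=a$, $B=b$, gains $K_+,K_-$, weights $s,r$ and scalars $p_+,p_-,h$ with $0\le\max\{p_+,p_-\}\le h\le\gamma$, conditions (i)–(iii) are: (i) $p_\sigma\ge s+K_\sigma r+(A+\sigma BK_\sigma)p_\sigma$ for all $\sigma\in\{+,-\}$; (ii) $h\ge s+K_kr+(A+\sigma BK_k)p_\sigma$ for all $k\ne\sigma$ in $\{+,-\}$; (iii) $hx\ge(s+rK_k+hA)x+(h-\gamma)|BK_kx|$ for $k\in\{+,-\}$ and all $x\ge0$. Histories along a trajectory: $z_0^{(\sigma)}=0$, $z_{t+1}^{(\sigma)}=z_t^{(\sigma)}+\gamma|x_{t+1}-ax_t-\sigma bu_t|$, $\sigma\in\{+,-\}$. Cost of a causal policy $\mu$ (with $|u_t|\le Ex_t$) from $x_0\ge0$: $$J_\mu(x_0)=\sup_{\sigma\in\{+,-\},\ w,\ T\in\mathbb N}\ \sum_{t=0}^T\bigl(x_t-\gamma|w_t|\bigr)\quad\text{subject to } x_{t+1}=ax_t+\sigma bu_t+w_t,$$ the supremum being over disturbance sequences with $w_t\ge-(ax_t+\sigma bu_t)$ for all $t$. *)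

(* Defs.v *)
From HB Require Import structures.
From mathcomp Require Import all_boot all_order all_algebra.
From mathcomp Require Import all_classical all_reals ereal.

Set Implicit Arguments.
Unset Strict Implicit.
Unset Printing Implicit Defensive.

Import Order.TTheory GRing.Theory Num.Theory.
Local Open Scope classical_set_scope.
Local Open Scope ring_scope.

(* The signs + and - are encoded as the booleans true and false. *)
Definition sgnb (R : realType) (sigma : bool) : R := if sigma then 1 else -1.

(* Sufficient conditions for general scalar data; K and p are indexed by signs,
   K true = K_+ and K false = K_-, likewise for p. *)
Section Conditions.
Context {R : realType}.
Implicit Types (A B s r h gamma : R) (K p : bool -> R).

Definition ordered_scalars p h gamma : Prop :=
  0 <= Num.max (p true) (p false) /\
  Num.max (p true) (p false) <= h /\ h <= gamma.

Definition cond_i A B s r K p : Prop :=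
  forall sigma : bool,
    p sigma >= s + K sigma * r + (A + sgnb R sigma * B * K sigma) * p sigma.

Definition cond_ii A B s r K p h : Prop :=
  forall k sigma : bool, k != sigma ->
    h >= s + K k * r + (A + sgnb R sigma * B * K k) * p sigma.

Definition cond_iii A B s r K h gamma : Prop :=
  forall (k : bool) (x : R), 0 <= x ->
    h * x >= (s + r * K k + h * A) * x + (h - gamma) * `|B * K k * x|.

End Conditions.

Section ClosedLoop.
Context {R : realType}.

Fixpoint hist (gamma a b : R) (x u : nat -> R) (sigma : bool) (t : nat) : R :=
  if t is t'.+1 then
    hist gamma a b x u sigma t' +
    gamma * `|x t'.+1 - a * x t' - sgnb R sigma * b * u t'|
  else 0.

(* A causal policy maps [:: x_0; ...; x_t] and [:: u_0; ...; u_(t-1)] to u_t. *)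
Definition policy : Type := seq R -> seq R -> R.

(* x_0, mu, sigma and w generate the trajectory (x, u), and w satisfies the
   constraint w_t >= -(a x_t + sigma b u_t), which keeps the state nonnegative. *)
Definition closed_loop (a b : R) (mu : policy) (x0 : R) (sigma : bool)
    (x u w : nat -> R) : Prop :=
  [/\ x 0%N = x0,
      forall t, u t = mu (mkseq x t.+1) (mkseq u t),
      forall t, x t.+1 = a * x t + sgnb R sigma * b * u t + w t
    & forall t, w t >= - (a * x t + sgnb R sigma * b * u t)].

Definition input_bounded (E a b : R) (mu : policy) (x0 : R) : Prop :=
  forall sigma x u w, closed_loop a b mu x0 sigma x u w ->
    forall t, `|u t| <= E * x t.

Definition cost (gamma a b : R) (mu : policy) (x0 : R) : \bar R :=
  ereal_sup [set v : \bar R | exists sigma x u w (T : nat),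
    closed_loop a b mu x0 sigma x u w /\
    v = (\sum_(0 <= t < T.+1) (x t - gamma * `|w t|))%:E].

(* The minimizer of z_t^(sigma) need not be unique (it never is at t = 0), so
   this holds of every policy obtained by some tie-breaking rule, which may
   depend on the whole observed history. *)
Definition CE_policy (gamma a b : R) (mu : policy) : Prop :=
  forall (x u : nat -> R) (t : nat), exists2 k : bool,
    forall sigma, hist gamma a b x u k t <= hist gamma a b x u sigma t
    & mu (mkseq x t.+1) (mkseq u t) = - sgnb R k * (a / b) * x t.

End ClosedLoop.

Section CertaintyEquivalence.
Context {R : realType}.
Implicit Types a b p h gamma : R.

Definition CE_gain a b (k : bool) : R := if k then - (a / b) else a / b.

Definition CE_cond_i a b p : Prop :=
  cond_i a b 1 0 (CE_gain a b) (fun=> p).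

Definition CE_cond_ii a b p h : Prop :=
  cond_ii a b 1 0 (CE_gain a b) (fun=> p) h.

Definition CE_cond_iii a b h gamma : Prop :=
  cond_iii a b 1 0 (CE_gain a b) h gamma.

Definition CE_feasible a b gamma p h : Prop :=
  [/\ 0 <= p <= gamma, 0 <= h <= gamma,
      CE_cond_i a b p, CE_cond_ii a b p h & CE_cond_iii a b h gamma].

Definition gammaCE a : R := Num.max (1 + 2 * a) (4 * a).

End CertaintyEquivalence.

(* Main.v *)
Require Import Defs.
From HB Require Import structures.
From mathcomp Require Import all_boot all_order all_algebra.
From mathcomp Require Import all_classical all_reals ereal.
From mathcomp Require Import ring lra.

Set Implicit Arguments.
Unset Strict Implicit.
Unset Printing Implicit Defensive.

Import Order.TTheory GRing.Theory Num.Theory.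
Local Open Scope classical_set_scope.
Local Open Scope ring_scope.

(** The gain [-k a/b] cancels the open-loop state [a x] when the guessed sign
    [k] is the true one and doubles it otherwise, so every coefficient
    [A + sigma B K_k] is [0] or [2 a], and the conditions (i)-(iii) become
    scalar inequalities.  They force [p >= 1] and [1 + 2 a <= h <= gamma],
    hence [gamma >= 1 + 2 a]; for [a >= 1/2] the third one,
    [(2 a - 1) h <= gamma a - 1], is an upper bound on [h], and comparing it
    with [h >= 1 + 2 a] gives [gamma >= 4 a].  At [gamma = gammaCE a] one of
    the two upper bounds on [h] meets the lower bound [1 + 2 a], which leaves
    a single feasible pair ([CE_feasible_gammaCE]).

    The cost bound rests on the value function
      [V(x, z) = max(p x - z_+, p x - z_-, h x - (z_+ + z_-) / 2)]
    of the state and of the two histories.  Each of its three terms describes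
    a level of knowledge: the sign is one of the two, or is still undecided.
    Along the CE controller, [x_t + V(x_(t+1), z_(t+1)) <= V(x_t, z_t)]
    whatever the disturbance ([value_step]): (i) handles the term of the
    guessed sign, (ii) that of the opposite sign, where the minimality of the
    guessed history lets the mean of the histories replace the larger one, and
    (iii) the term with the mean.  Telescoping, and using that
    [V(x, z) >= - z_sigma] while the history of the true sign is exactly the
    penalty paid by the disturbance, the cost is at most [V(x_0, 0)], which is
    [h x_0] when [p <= h] ([CE_cost_le]). *)

(** * The scalar form of the sufficient conditions *)

Section Reduction.
Variables (R : realType) (a b : R).
Hypotheses (a_gt0 : 0 < a) (b_gt0 : 0 < b).

Lemma CE_closed_gain (k sigma : bool) :
  a + sgnb R sigma * b * CE_gain a b k = if k == sigma then 0 else 2 * a.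
Proof.
have b_neq0 : b != 0 by rewrite gt_eqF.
by case: k sigma => [] []; rewrite /CE_gain /sgnb /=; field.
Qed.

Lemma CE_cond_iE p : CE_cond_i a b p <-> p >= 1.
Proof.
split=> [/(_ true)|p_ge1 sigma]; rewrite CE_closed_gain eqxx; lra.
Qed.

Lemma CE_cond_iiE p h : CE_cond_ii a b p h <-> h >= 1 + 2 * a * p.
Proof.
split=> [/(_ true false isT)|h_ge k sigma /negPf k_sigma].
  by rewrite CE_closed_gain /=; lra.
by rewrite CE_closed_gain k_sigma; lra.
Qed.

Lemma CE_cond_iiiE h gamma :
  CE_cond_iii a b h gamma <-> h >= 1 + 2 * a * h - gamma * a.
Proof.
have normBK k x : 0 <= x -> `|b * CE_gain a b k * x| = a * x.
  move=> x_ge0.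
  have -> : b * CE_gain a b k = if k then - a else a.
    have b_neq0 : b != 0 by rewrite gt_eqF.
    by case: k; rewrite /CE_gain; field.
  by rewrite normrM (ger0_norm x_ge0); case: k; rewrite ?normrN gtr0_norm.
split=> [/(_ true 1 ler01)|h_ge k x x_ge0]; rewrite normBK //; first lra.
nra.
Qed.

Lemma CE_feasibleE gamma p h :
  CE_feasible a b gamma p h <->
  [/\ 1 <= p <= gamma, h <= gamma, 1 + 2 * a * p <= h
    & 1 + 2 * a * h - gamma * a <= h].
Proof.
split=> [[/andP[_ ->] /andP[_ h_le] /CE_cond_iE -> /CE_cond_iiE -> ]|].
  by move=> /CE_cond_iiiE ->.
move=> [/andP[p_ge1 p_le] h_le h_ge ii].
have ap_ge0 : 0 <= a * p by rewrite mulr_ge0 ?ltW //; lra.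
split; [lra|lra| | |].
- exact/CE_cond_iE.
- exact/CE_cond_iiE.
- exact/CE_cond_iiiE.
Qed.

(** * The smallest feasible [gamma] *)

Lemma gammaCE_small : a <= 1 / 2 -> gammaCE a = 1 + 2 * a.
Proof. by move=> a_le; apply/max_idPl; lra. Qed.

Lemma gammaCE_large : 1 / 2 <= a -> gammaCE a = 4 * a.
Proof. by move=> a_ge; apply/max_idPr; lra. Qed.

Lemma gammaCE_le gamma p h : CE_feasible a b gamma p h -> gammaCE a <= gamma.
Proof.
move=> /CE_feasibleE[/andP[p_ge1 _] h_le h_ge iii].
have h_ge' : 1 + 2 * a <= h by nra.
case: (leP a (1 / 2)) => [a_le|a_gt]; first by rewrite gammaCE_small //; lra.
rewrite gammaCE_large ?(ltW a_gt) // -(ler_pM2l a_gt0).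
(* (iii) gives [gamma a >= 1 + (2 a - 1) h], and here [2 a - 1] is positive *)
have : (2 * a - 1) * (1 + 2 * a) <= (2 * a - 1) * h.
  by rewrite ler_pM2l //; lra.
lra.
Qed.

Lemma CE_feasible_gammaCE p h :
  CE_feasible a b (gammaCE a) p h <-> p = 1 /\ h = 1 + 2 * a.
Proof.
have a_pos := a_gt0.
rewrite CE_feasibleE; case: (leP a (1 / 2)) => [a_le|a_gt].
- rewrite gammaCE_small //; split=> [[/andP[p_ge1 _] h_le h_ge _]|[-> ->]].
    have ap_le : a * p <= a * 1 by lra.
    have p_eq1 : p = 1.
      by apply/eqP; rewrite eq_le p_ge1 andbT -(ler_pM2l a_gt0).
    by split=> //; move: h_ge; rewrite p_eq1; lra.
  by split; [lra|lra|lra|nra].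
- rewrite gammaCE_large ?(ltW a_gt) //.
  split=> [[/andP[p_ge1 _] _ h_ge iii]|[-> ->]]; last by split; lra.
  have h_le : h <= 1 + 2 * a.
    have c_gt0 : 0 < 2 * a - 1 by lra.
    by rewrite -(ler_pM2l c_gt0); lra.
  have p_eq1 : p = 1.
    by apply/eqP; rewrite eq_le p_ge1 andbT -(ler_pM2l a_gt0); lra.
  by split=> //; move: h_ge; rewrite p_eq1; lra.
Qed.

End Reduction.

(** * The value function of the certainty equivalence controller *)

Section Value.
Variable R : realType.
Implicit Types (a b p h gamma c x y : R) (z : bool -> R).

Definition value p h x z : R :=
  Num.max (Num.max (p * x - z true) (p * x - z false))
          (h * x - (z true + z false) / 2).

(** The signs are named from an arbitrary [k] so that the three terms can be
    matched with the guessed sign, the opposite one and the undecided case. *)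
Lemma value_le p h x z c k :
  value p h x z <= c <->
  [/\ p * x - z k <= c, p * x - z (~~ k) <= c
    & h * x - (z k + z (~~ k)) / 2 <= c].
Proof.
rewrite /value !ge_max -andbA; split=> [/and3P[]|[]]; case: k => /=.
- by [].
- by move=> ? ? ?; split=> //; rewrite (addrC (z false)).
- by move=> ? ? ?; apply/and3P.
- by move=> ? ? ?; apply/and3P; split=> //; rewrite (addrC (z true)).
Qed.

(** The closed loop puts the predictions of the two models at [0] (guessed
    sign [k]) and [2 a x] (opposite sign), hence the increments of the
    histories.  In the term with the mean, [h <= gamma] makes [y = 2 a x] the
    worst next state: the mean increment is the constant [gamma a x] below
    it, and grows with slope [gamma] above it. *)
Lemma value_step a gamma p h x y z z' k :
  0 <= a -> 0 <= x -> 0 <= y -> 1 <= p <= gamma -> h <= gamma ->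
  1 + 2 * a * p <= h -> 1 + 2 * a * h - gamma * a <= h ->
  z k <= z (~~ k) ->
  z' k = z k + gamma * y -> z' (~~ k) = z (~~ k) + gamma * `|y - 2 * a * x| ->
  x + value p h y z' <= value p h x z.
Proof.
move=> a_ge0 x_ge0 y_ge0 /andP[p_ge1 p_le] h_le ii iii z_min z'k z'Nk.
have [Vk _ Vmean] := (value_le p h x z _ k).1 (lexx _).
rewrite -lerBrDl; apply/(value_le _ _ _ _ _ k); rewrite z'k z'Nk.
set e := `|_|.
have e_ge : y - 2 * a * x <= e by exact: ler_norm.
have e_ge0 : 0 <= e by exact: normr_ge0.
have x_iii : (1 + 2 * a * h - gamma * a) * x <= h * x by exact: ler_wpM2r.
split.
- have : x <= p * x by rewrite ler_peMl.
  have : p * y <= gamma * y by exact: ler_wpM2r.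
  lra.
- have : (1 + 2 * a * p) * x <= h * x by exact: ler_wpM2r.
  have : p * (y - 2 * a * x) <= p * e by rewrite ler_wpM2l //; lra.
  have : p * e <= gamma * e by exact: ler_wpM2r.
  lra.
- case: (leP y (2 * a * x)) => [y_le|y_gt].
    have e_eq : e = 2 * a * x - y by rewrite /e ler0_norm; lra.
    have ap_ge0 : 0 <= a * p by rewrite mulr_ge0 //; lra.
    have h_ge0 : 0 <= h by lra.
    have : h * y <= h * (2 * a * x) by exact: ler_wpM2l.
    rewrite e_eq; lra.
  have e_eq : e = y - 2 * a * x by rewrite /e gtr0_norm; lra.
  have : h * (y - 2 * a * x) <= gamma * (y - 2 * a * x).
    by rewrite ler_wpM2r //; lra.
  rewrite e_eq; lra.
Qed.

End Value.

(** * Trajectories of the certainty equivalence controller *)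

Section Trajectory.
Variables (R : realType) (a b gamma : R) (mu : policy (R := R)) (x0 : R).
Variables (sigma : bool) (x u w : nat -> R).
Hypotheses (a_gt0 : 0 < a) (b_gt0 : 0 < b) (x0_ge0 : 0 <= x0).
Hypotheses (mu_CE : CE_policy gamma a b mu).
Hypothesis traj : closed_loop a b mu x0 sigma x u w.

Lemma closed_loop_ge0 t : 0 <= x t.
Proof.
case: traj => x_0 _ x_next w_ge; case: t => [|t]; first by rewrite x_0.
by rewrite x_next; have := w_ge t; lra.
Qed.

(** The residual of the true model is the disturbance itself. *)
Lemma hist_true_sign t :
  hist gamma a b x u sigma t = \sum_(0 <= i < t) gamma * `|w i|.
Proof.
case: traj => _ _ x_next _; elim: t => [|t IH]; first by rewrite big_nil.
rewrite big_nat_recr //= IH x_next; congr (_ + gamma * `|_|); lra.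
Qed.

Lemma CE_input t : exists2 k : bool,
  hist gamma a b x u k t <= hist gamma a b x u (~~ k) t
  & b * u t = - sgnb R k * a * x t.
Proof.
case: traj => _ u_mu _ _; have [k k_min mu_k] := mu_CE x u t.
exists k => //; rewrite u_mu mu_k.
have b_neq0 : b != 0 by rewrite gt_eqF.
by field.
Qed.

Lemma CE_input_norm t : `|u t| = a / b * x t.
Proof.
have x_ge0 := closed_loop_ge0 t; have [k _ bu] := CE_input t.
have -> : u t = - sgnb R k * (a / b * x t).
  have b_neq0 : b != 0 by rewrite gt_eqF.
  by apply: (mulfI b_neq0); rewrite bu; field.
rewrite normrM normrN (_ : `|sgnb R k| = 1); last first.
  by case: k {bu}; rewrite /sgnb ?normrN normr1.
by rewrite mul1r ger0_norm // mulr_ge0 // divr_ge0 // ltW.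
Qed.

Variables (p h : R).
Hypothesis (feasible : CE_feasible a b gamma p h) (p_le_h : p <= h).

Lemma CE_value_step t :
  x t + value p h (x t.+1) ((hist gamma a b x u)^~ t.+1) <=
  value p h (x t) ((hist gamma a b x u)^~ t).
Proof.
have [p_bnd h_le ii iii] := (CE_feasibleE a_gt0 b_gt0 _ _ _).1 feasible.
have [k k_min bu] := CE_input t.
have y_ge0 := closed_loop_ge0 t.+1.
apply: (value_step (gamma := gamma) (k := k) (ltW a_gt0)) => //.
- exact: closed_loop_ge0.
- rewrite /= -[in RHS](ger0_norm y_ge0); congr (_ + gamma * `|_|).
  by rewrite -mulrA bu; case: k {k_min bu}; rewrite /sgnb; ring.
- rewrite /=; congr (_ + gamma * `|_|).
  by rewrite -mulrA bu; case: k {k_min bu}; rewrite /sgnb /=; ring.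
Qed.

Lemma CE_value_telescope n :
  \sum_(0 <= t < n) x t + value p h (x n) ((hist gamma a b x u)^~ n) <= h * x0.
Proof.
elim: n => [|n IH]; last first.
  rewrite big_nat_recr //= -addrA; apply: le_trans IH.
  by rewrite lerD2l CE_value_step.
case: traj => x_0 _ _ _; rewrite big_nil add0r x_0.
have p_le : p * x0 <= h * x0 by exact: ler_wpM2r.
by apply/(value_le _ _ _ _ _ true) => /=; split; lra.
Qed.

Lemma CE_partial_cost_le T :
  \sum_(0 <= t < T.+1) (x t - gamma * `|w t|) <= h * x0.
Proof.
have [/andP[p_ge1 _] _ _ _] := (CE_feasibleE a_gt0 b_gt0 _ _ _).1 feasible.
rewrite sumrB -hist_true_sign; apply: le_trans (CE_value_telescope T.+1).
rewrite lerD2l; set z := (hist gamma a b x u)^~ T.+1.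
have [Vsigma _ _] := (value_le p h (x T.+1) z _ sigma).1 (lexx _).
apply: le_trans Vsigma; rewrite lerDr mulr_ge0 ?closed_loop_ge0 //; lra.
Qed.

End Trajectory.

Lemma CE_cost_le (R : realType) (a b gamma p h : R) (mu : policy) (x0 : R) :
  0 < a -> 0 < b -> 0 <= x0 -> CE_policy gamma a b mu ->
  CE_feasible a b gamma p h -> p <= h ->
  (cost gamma a b mu x0 <= (h * x0)%:E)%E.
Proof.
move=> a_gt0 b_gt0 x0_ge0 mu_CE feasible p_le_h; apply: ge_ereal_sup.
move=> _ [sigma [x [u [w [T [traj ->]]]]]]; rewrite lee_fin.
exact: (CE_partial_cost_le a_gt0 b_gt0 x0_ge0 mu_CE traj feasible p_le_h).
Qed.

Theorem corollary1 (R : realType) (a b : R) (a_gt0 : 0 < a) (b_gt0 : 0 < b) :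
  (* reduction of the sufficient conditions *)
  (forall gamma p h : R,
     [/\ CE_cond_i a b p <-> p >= 1,
         CE_cond_ii a b p h <-> h >= 1 + 2 * a * p
       & CE_cond_iii a b h gamma <-> h >= 1 + 2 * a * h - gamma * a]) /\
  (* gammaCE a is the smallest feasible gamma *)
  ((exists p h : R, CE_feasible a b (gammaCE a) p h) /\
   (forall gamma : R,
      (exists p h : R, CE_feasible a b gamma p h) -> gammaCE a <= gamma)) /\
  ((a <= 1 / 2 -> gammaCE a = 1 + 2 * a) /\
   (1 / 2 <= a -> gammaCE a = 4 * a)) /\
  (* the minimizing values *)
  ((forall p h : R,
      CE_feasible a b (gammaCE a) p h <-> p = 1 /\ h = 1 + 2 * a) /\
   ordered_scalars (fun=> 1) (1 + 2 * a) (gammaCE a)) /\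
  (* the cost bound *)
  (forall (mu : policy) (x0 : R), CE_policy (gammaCE a) a b mu -> 0 <= x0 ->
     input_bounded (a / b) a b mu x0 /\
     (cost (gammaCE a) a b mu x0 <= ((1 + 2 * a) * x0)%:E)%E).
Proof.
have feasible : CE_feasible a b (gammaCE a) 1 (1 + 2 * a).
  exact/CE_feasible_gammaCE.
split=> [gamma p h|].
  by split; [exact: CE_cond_iE|exact: CE_cond_iiE|exact: CE_cond_iiiE].
split.
  split; first by exists 1, (1 + 2 * a).
  by move=> gamma [p [h]]; exact: gammaCE_le.
split; first by split; [exact: gammaCE_small|exact: gammaCE_large].
split.
  split; first exact: CE_feasible_gammaCE.
  rewrite /ordered_scalars maxxx ler01; split=> //; split; first lra.
  by rewrite /gammaCE le_max lexx.
move=> mu x0 mu_CE x0_ge0; split; last first.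
  by apply: CE_cost_le feasible _ => //; lra.
move=> sigma x u w traj t.
by rewrite (CE_input_norm a_gt0 b_gt0 x0_ge0 mu_CE traj).
Qed.
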